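(* Let $R$ be a semiperfect ring, let $S$ be a basic ring that is Morita equivalent to $R$ over $\mathrm{Cent}(R)$, and let $\sigma\in\mathrm{Aut}(\mathrm{Cent}(R))$. If $R$ has an involution of type $\sigma$, then so does the matrix ring $\mathrm{M}_2(S)$.
   Context: Rings are unital. $R$ is semiperfect if $R/\mathrm{Jac}(R)$ is semisimple artinian and idempotents lift modulo the Jacobson radical $\mathrm{Jac}(R)$. A semiperfect ring has finitely many indecomposable finitely generated projective right modules $P_1,\dots,P_t$ up to isomorphism, and $R_R\cong\bigoplus_i P_i^{m_i}$ with uniquely determined $m_i\ge 1$; it is called basic if $m_1=\dots=m_t=1$. Every semiperfect $R$ is Morita equivalent over $\mathrm{Cent}(R)$ to a basic ring, unique up to isomorphism of $\mathrm{Cent}(R)$-algebras, namely $\mathrm{End}_R(P_1\oplus\dots\oplus P_t)$. An $(S,R)$-progenerator is an $(S,R)$-bimodule $P$ such that $P_R$ is a finitely generated projective generator and every endomorphism of $P_R$ has the form $p\mapsto sp$ for a unique $s\in S$. Two $C$-algebras $R,S$ ($C$ commutative) are Morita equivalent over $C$ if there is an $(S,R)$-progenerator $P$ with $cp=pc$ for all $c\in C,\ p\in P$. An involution of a ring is an anti-automorphism $\alpha$ with $\alpha\circ\alpha=\mathrm{id}$. Its type, for a central $C$-algebra (one for which $c\mapsto c\cdot 1$ is an isomorphism from $C$ onto the center), is its restriction to the center, viewed as an automorphism of $C$. Here $C=\mathrm{Cent}(R)$, and $S$ and $\mathrm{M}_2(S)$ are central $C$-algebras ($C$ acting on $\mathrm{M}_2(S)$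 by scalar matrices). *)

(* Defs.v *)
From HB Require Import structures.
From mathcomp Require Import all_boot all_order all_algebra.
From mathcomp Require Import boolp classical_sets.

Set Implicit Arguments.
Unset Strict Implicit.
Unset Printing Implicit Defensive.

Import GRing.Theory.
Local Open Scope classical_set_scope.
Local Open Scope ring_scope.

(* Rings are [pzRingType]s (unital, noncommutative, possibly zero), and right
   R-modules are left modules over the converse ring [R^c]: for [x : M] and
   [r : R], the product x r is [(r : R^c) *: x].  In particular R_R is
   [(R^c)^o]. *)
Notation rmodType R := (lmodType R^c).
Notation regular_rmod R := ((R^c)^o : rmodType R).

Section Ideals.
Variable R : pzRingType.
Implicit Types I J M : set R.

Definition right_ideal I : Prop :=
  [/\ I 0, forall x y, I x -> I y -> I (x + y) & forall x r, I x -> I (x * r)].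

Definition maximal_right_ideal M : Prop :=
  [/\ right_ideal M, M != setT
    & forall I, right_ideal I -> M `<=` I -> I = M \/ I = setT].

Definition Jac : set R :=
  [set x | forall M, maximal_right_ideal M -> M x].

Definition right_artinian : Prop :=
  forall I_ : nat -> set R,
    (forall n, right_ideal (I_ n)) -> (forall n, I_ n.+1 `<=` I_ n) ->
    exists N, forall n, (N <= n)%N -> I_ n = I_ N.

Definition semisimple : Prop :=
  forall I, right_ideal I ->
    exists J, [/\ right_ideal J, I `&` J = [set 0]
                & forall x, exists y z, [/\ I y, J z & x = y + z]].

End Ideals.

(* [pi] exhibits [Q] as the quotient R / I. *)
Definition is_quotient (R Q : pzRingType) (I : set R)
    (pi : {rmorphism R -> Q}) : Prop :=
  (forall q, exists x, pi x = q) /\ (forall x, pi x = 0 <-> I x).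

Definition semiperfect (R : pzRingType) : Prop :=
  (exists (Q : pzRingType) (pi : {rmorphism R -> Q}),
     [/\ is_quotient (Jac (R := R)) pi, semisimple Q & right_artinian Q]) /\
  (forall a : R, Jac (a * a - a) ->
     exists e : R, e * e = e /\ Jac (e - a)).

Definition dsum (A : pzRingType) (I : finType) (M : I -> lmodType A) :=
  {dffun forall i : I, M i}.

Section DirectSum.
Variables (A : pzRingType) (I : finType) (M : I -> lmodType A).
Implicit Types f g h : dsum M.

HB.instance Definition _ := Choice.on (dsum M).

Definition dsum_zero : dsum M := [ffun i => 0].
Definition dsum_opp f : dsum M := [ffun i => - f i].
Definition dsum_add f g : dsum M := [ffun i => f i + g i].
Definition dsum_scale (a : A) f : dsum M := [ffun i => a *: f i].

Fact dsum_addA : associative dsum_add.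
Proof. by move=> f g h; apply/ffunP=> i; rewrite !ffunE addrA. Qed.
Fact dsum_addC : commutative dsum_add.
Proof. by move=> f g; apply/ffunP=> i; rewrite !ffunE addrC. Qed.
Fact dsum_add0 : left_id dsum_zero dsum_add.
Proof. by move=> f; apply/ffunP=> i; rewrite !ffunE add0r. Qed.
Fact dsum_addN : left_inverse dsum_zero dsum_opp dsum_add.
Proof. by move=> f; apply/ffunP=> i; rewrite !ffunE addNr. Qed.

HB.instance Definition _ := GRing.isZmodule.Build (dsum M)
  dsum_addA dsum_addC dsum_add0 dsum_addN.

Fact dsum_scaleA a b f : dsum_scale a (dsum_scale b f) = dsum_scale (a * b) f.
Proof. by apply/ffunP=> i; rewrite !ffunE scalerA. Qed.
Fact dsum_scale1 : left_id 1 dsum_scale.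
Proof. by move=> f; apply/ffunP=> i; rewrite !ffunE scale1r. Qed.
Fact dsum_scaleDr : right_distributive dsum_scale +%R.
Proof. by move=> a f g; apply/ffunP=> i; rewrite !ffunE scalerDr. Qed.
Fact dsum_scaleDl f : {morph dsum_scale^~ f : a b / a + b}.
Proof. by move=> a b; apply/ffunP=> i; rewrite !ffunE scalerDl. Qed.

HB.instance Definition _ := GRing.Zmodule_isLmodule.Build A (dsum M)
  dsum_scaleA dsum_scale1 dsum_scaleDr dsum_scaleDl.

End DirectSum.

Section Modules.
Variable A : pzRingType.
Implicit Types M N P : lmodType A.

Definition isomorphic M N : Prop := exists f : {linear M -> N}, bijective f.

Definition finitely_generated M : Prop :=
  exists (n : nat) (x : 'I_n -> M),
    forall y, exists a : 'I_n -> A, y = \sum_(i < n) a i *: x i.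

Definition projective P : Prop :=
  forall M N (g : {linear M -> N}) (f : {linear P -> N}),
    (forall y, exists x, g x = y) -> exists h : {linear P -> M}, g \o h =1 f.

(* The functor Hom(P, -) is faithful. *)
Definition generator P : Prop :=
  forall M N (f g : {linear M -> N}),
    (forall h : {linear P -> M}, f \o h =1 g \o h) -> f =1 g.

Definition indecomposable M : Prop :=
  (exists x : M, x != 0) /\
  forall M1 M2 : lmodType A, isomorphic M (M1 * M2)%type ->
    (forall x : M1, x = 0) \/ (forall x : M2, x = 0).

End Modules.

(* [P] lists the indecomposable finitely generated projective right
   R-modules, once each up to isomorphism, and R_R is the direct sum of the
   P_i ^ (m_i) with m_i >= 1. *)
Definition indecomposable_decomposition (R : pzRingType) (t : nat)
    (P : 'I_t -> rmodType R) (m : 'I_t -> nat) : Prop :=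
  [/\ forall i,
        [/\ indecomposable (P i), finitely_generated (P i) & projective (P i)],
      forall i j, isomorphic (P i) (P j) -> i = j,
      forall N : rmodType R,
        indecomposable N -> finitely_generated N -> projective N ->
        exists i, isomorphic N (P i),
      forall i, (1 <= m i)%N
    & isomorphic (regular_rmod R)
        (dsum (fun i : 'I_t => {ffun 'I_(m i) -> P i} : rmodType R))].

Definition basic (R : pzRingType) : Prop :=
  semiperfect R /\
  exists (t : nat) (P : 'I_t -> rmodType R) (m : 'I_t -> nat),
    indecomposable_decomposition P m /\ forall i, m i = 1%N.

(* The library's [algType C] only contains nonzero rings, and 'M[A]_n carries
   no C-module structure when A is a C-algebra; so a C-algebra is given here by
   its structure map c |-> c . 1, with values in the center. *)
Record calgType (C : comPzRingType) := CAlgebra {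
  calg_ring :> pzRingType;
  calg_map : {rmorphism C -> calg_ring};
  calg_mapC : forall c (a : calg_ring), calg_map c * a = a * calg_map c
}.

Section Center.
Variable R : pzRingType.

Definition center : {pred R} := fun x => `[< forall y : R, x * y = y * x >].

Lemma centerP x : reflect (forall y : R, x * y = y * x) (x \in center).
Proof. exact: asboolP. Qed.

Fact center_subring_closed : subring_closed center.
Proof.
split=> [|x y /centerP xC /centerP yC|x y /centerP xC /centerP yC];
  apply/centerP => z; first by rewrite mul1r mulr1.
- by rewrite mulrBl mulrBr xC yC.
- by rewrite -mulrA yC mulrA xC mulrA.
Qed.

Record Cent : Type := CentElt { cent_val :> R; _ : cent_val \in center }.

HB.instance Definition _ := [isSub for cent_val].
HB.instance Definition _ := [Choice of Cent by <:].
HB.instance Definition _ :=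
  GRing.SubChoice_isSubPzRing.Build R center Cent center_subring_closed.

Fact Cent_mulC : commutative (@GRing.mul Cent).
Proof.
by move=> x y; apply: val_inj; rewrite !rmorphM; exact/centerP/(valP x).
Qed.

HB.instance Definition _ := GRing.PzRing_hasCommutativeMul.Build Cent Cent_mulC.

Fact Cent_algC (c : Cent) (a : R) :
  (val : {rmorphism Cent -> R}) c * a = a * (val : {rmorphism Cent -> R}) c.
Proof. exact/centerP/(valP c). Qed.

Definition Cent_alg : calgType Cent := CAlgebra Cent_algC.

End Center.

Section MatrixAlgebra.
Variables (C : comPzRingType) (n : nat) (A : calgType C).

Definition mx_alg_map (c : C) : 'M[A]_n := (calg_map A c)%:M.

Fact mx_alg_map_zmod : zmod_morphism mx_alg_map.
Proof. by move=> c d; rewrite /mx_alg_map rmorphB raddfB. Qed.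

Fact mx_alg_map_monoid : monoid_morphism mx_alg_map.
Proof.
by split=> [|c d]; rewrite /mx_alg_map ?rmorph1 // rmorphM scalar_mxM.
Qed.

HB.instance Definition _ :=
  GRing.isZmodMorphism.Build C 'M[A]_n mx_alg_map mx_alg_map_zmod.
HB.instance Definition _ :=
  GRing.isMonoidMorphism.Build C 'M[A]_n mx_alg_map mx_alg_map_monoid.

Fact mx_alg_mapC (c : C) (a : 'M[A]_n) :
  (mx_alg_map : {rmorphism C -> 'M[A]_n}) c * a
    = a * (mx_alg_map : {rmorphism C -> 'M[A]_n}) c.
Proof.
apply/matrixP => i j; rewrite /= /mx_alg_map !mxE.
rewrite (bigD1 i) //= big1 => [|k /negPf ki]; last first.
  by rewrite !mxE eq_sym ki mulr0n mul0r.
rewrite [RHS](bigD1 j) //= big1 => [|k /negPf kj]; last first.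
  by rewrite !mxE kj mulr0n mulr0.
by rewrite !mxE !eqxx !mulr1n !addr0 calg_mapC.
Qed.

Definition mx_alg : calgType C := CAlgebra mx_alg_mapC.

End MatrixAlgebra.

(* [act s] is the left multiplication by [s]; it is right R-linear by typing. *)
Definition bimodule (S R : pzRingType) (P : rmodType R)
    (act : S -> {linear P -> P}) : Prop :=
  [/\ forall p, act 1 p = p,
      forall s t p, act (s + t) p = act s p + act t p
    & forall s t p, act (s * t) p = act s (act t p)].

Definition progenerator (S R : pzRingType) (P : rmodType R)
    (act : S -> {linear P -> P}) : Prop :=
  [/\ bimodule act,
      finitely_generated P, projective P, generator P
    & forall f : {linear P -> P}, exists! s : S, forall p, f p = act s p].

Definition morita_equivalent (C : comPzRingType) (R S : calgType C) : Prop :=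
  exists (P : rmodType R) (act : S -> {linear P -> P}),
    progenerator act /\
    forall (c : C) (p : P), act (calg_map S c) p = (calg_map R c : R^c) *: p.

Definition central (C : comPzRingType) (A : calgType C) : Prop :=
  injective (calg_map A) /\
  forall z : A, z \in center (R := A) -> exists c, calg_map A c = z.

(* An anti-endomorphism of A is a ring morphism to the converse ring. *)
Definition involution (A : pzRingType) (alpha : {rmorphism A -> A^c}) : Prop :=
  forall x : A, alpha (alpha x) = x.

(* The type of an involution is only defined for central algebras. *)
Definition has_involution_of_type (C : comPzRingType) (A : calgType C)
    (sigma : {rmorphism C -> C}) : Prop :=
  central A /\
  exists alpha : {rmorphism A -> A^c},
    involution alpha /\
    forall c : C, alpha (calg_map A c) = calg_map A (sigma c).

(* Main.v *)
Require Import Defs.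
From HB Require Import structures.
From mathcomp Require Import all_boot all_order all_algebra.
From mathcomp Require Import generic_quotient ring_quotient.
From mathcomp Require Import boolp classical_sets.

(* Let P be the given (S,R)-progenerator and P' = Hom_R(P,R), made a right
   R-module through the involution alpha of R. Then End(P) = S, End(P') = S^op,
   and P, P' generate each other. Since S is basic, this makes each of them a
   direct summand of the other, and since S is Dedekind-finite they are
   isomorphic. The isomorphism is a regular alpha-sesquilinear form b on P, and
   h(u,v) = b(u_0,v_1) + alpha(b(v_0,u_1)) is a regular hermitian form on P^2,
   whose adjoint involution on End(P^2) = M_2(S) restricts to sigma on the
   center.

   The consequences of basicness used here are left-right symmetric, so they
   serve for S^op as well: S is Dedekind-finite, and every square matrix m over
   S with trace 1 satisfies s m s' = 1 for some row s and column s' (applied to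
   the matrix of all composites of given maps P' -> P -> P'). *)

Set Implicit Arguments.
Unset Strict Implicit.
Unset Printing Implicit Defensive.

Import GRing.Theory.
Local Open Scope ring_scope.

(** * The Jacobson radical and von Neumann regularity *)

Section Jacobson.
Variable R : pzRingType.
Implicit Types (x y : R) (I : set R).
Local Open Scope classical_set_scope.

Lemma maximal_right_ideal_exists I : right_ideal I -> ~ I 1 ->
  exists M, [/\ maximal_right_ideal M, I `<=` M & ~ M 1].
Proof.
move=> Iid I1.
(* Zorn's lemma also meets the empty chain, whose union is empty; hence the condition on the union
   of X with I. *)
pose P X := right_ideal (X `|` I) /\ ~ (X `|` I) 1.
have [F FP Ftot|A [[AI A1] Amax]] := @Zorn_bigcup R P.
  have FI (X : set R) : F X -> X `|` I `<=` (\bigcup_(X in F) X) `|` I.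
    by move=> FX x [Xx|]; [left; exists X|right].
  have common x y :
      (\bigcup_(X in F) X `|` I) x -> (\bigcup_(X in F) X `|` I) y ->
      (I x /\ I y) \/ exists X, [/\ F X, (X `|` I) x & (X `|` I) y].
    move=> [[X FX Xx]|Ix] [[Y FY Yy]|Iy].
    - have [XY|YX] := Ftot _ _ FX FY; right.
        by exists Y; split=> //; left => //; exact: XY.
      by exists X; split=> //; left => //; exact: YX.
    - by right; exists X; split=> //; [left|right].
    - by right; exists Y; split=> //; [right|left].
    - by left.
  have [I0 ID IM] := Iid.
  split; first split.
  - by right.
  - move=> x y Fx Fy; case: (common _ _ Fx Fy) => [[Ix Iy]|[X [FX Xx Xy]]].
      by right; exact: ID.
    by apply: (FI _ FX); have [_ D _] := (FP _ FX).1; exact: D.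
  - move=> x r Fx; case: (common _ _ Fx Fx) => [[Ix _]|[X [FX Xx _]]].
      by right; exact: IM.
    by apply: (FI _ FX); have [_ _ M] := (FP _ FX).1; exact: M.
  - by move=> F1; case: (common _ _ F1 F1) => [[]//|[X [/FP[_ X1]]]].
exists (A `|` I); split => //.
split=> //.
  by apply/eqP => AT; apply: A1; rewrite AT.
move=> K Kid AK; have [K1|K1] := pselect (K 1).
  right; apply/seteqP; split=> // x _.
  by have [_ _ /(_ 1 x K1)] := Kid; rewrite mul1r.
left; apply/seteqP; split=> //; apply: contrapT => KA.
apply: (Amax K); first split.
- by move=> x Ax; apply: AK; left.
- by move=> KA'; apply: KA => x /KA' Ax; left.
- rewrite /P; have -> : K `|` I = K by apply/setUidPl => x Ix; apply: AK; right.
  by split.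
Qed.

(** Otherwise the right ideal generated by 1 - x lies in a maximal one, which also contains x and
    hence 1. *)
Lemma Jac_right_inverse x : Jac x -> exists y, (1 - x) * y = 1.
Proof.
move=> Jx; apply: contrapT => noinv.
pose I := [set z | exists y, (1 - x) * y = z].
have [||M [Mmax IM M1]] := @maximal_right_ideal_exists I.
- split=> [|_ _ [a <-] [b <-]|_ r [a <-]].
  + by exists 0; rewrite mulr0.
  + by exists (a + b); rewrite mulrDr.
  + by exists (a * r); rewrite mulrA.
- exact: noinv.
apply: M1; have [[_ MD _] _ _] := Mmax.
rewrite -(subrK x 1); apply: MD; first by apply: IM; exists 1; rewrite mulr1.
exact: Jx.
Qed.

(** Let K be a complement of xR and 1 = xy + z with z in K; then zx = x - xyx lies in both xR and
    K. *)
Lemma semisimple_regular x : semisimple R -> exists y, x * y * x = x.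
Proof.
move=> /(_ [set z | exists y, x * y = z]) [].
  split=> [|_ _ [a <-] [b <-]|_ r [a <-]].
  - by exists 0; rewrite mulr0.
  - by exists (a + b); rewrite mulrDr.
  - by exists (a * r); rewrite mulrA.
move=> K [[K0 KD KM] IK /(_ 1) [_ [z [[y <-] Kz xy1]]]]; exists y.
suff zx0 : z * x = 0 by rewrite -[RHS]mul1r xy1 mulrDl zx0 addr0.
have : ([set u | exists v, x * v = u] `&` K) (z * x).
  split; last exact: KM.
  by exists (1 - y * x); rewrite mulrBr mulr1 mulrA -[X in X - _]mul1r xy1
     mulrDl addrAC subrr add0r.
by rewrite IK.
Qed.

End Jacobson.

(** * Primitive idempotents modulo the radical *)

Section PrimitiveIdempotents.
Variables (S Q : pzRingType) (pi : {rmorphism S -> Q}).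
(** What semiperfectness supplies about the projection onto S / Jac(S), with all witnesses taken in
    S. *)
Hypothesis right_inverse : forall x, pi x = 0 -> exists y, (1 - x) * y = 1.
Hypothesis pi_regular : forall x, exists y, pi (x * y * x) = pi x.
Hypothesis pi_lift :
  forall a, pi (a * a) = pi a -> exists f, f * f = f /\ pi f = pi a.

(** The right inverse v of u again maps to 1, so it has a right inverse too, which must be u. *)
Lemma unit_lift u : pi u = 1 -> exists v, u * v = 1 /\ v * u = 1.
Proof.
move=> u1; have [|v] := @right_inverse (1 - u).
  by rewrite rmorphB rmorph1 u1 subrr.
rewrite opprB addrCA subrr addr0 => uv1.
have v1 : pi v = 1 by rewrite -(rmorph1 pi) -uv1 rmorphM u1 mul1r.
have [|w] := @right_inverse (1 - v).
  by rewrite rmorphB rmorph1 v1 subrr.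
rewrite opprB addrCA subrr addr0 => vw1.
by exists v; split=> //; rewrite -[u]mulr1 -vw1 (mulrA u) uv1 mul1r.
Qed.

(** 1 - e is invertible and annihilates e. *)
Lemma idempotent_ker e : e * e = e -> pi e = 0 -> e = 0.
Proof.
move=> ee e0; have [|v [_ vu]] := @unit_lift (1 - e).
  by rewrite rmorphB rmorph1 e0 subr0.
by rewrite -[e]mul1r -vu -mulrA mulrBl mul1r ee subrr mulr0.
Qed.

(* With u = 1 - f (1 - e) for a lift f of a, the conjugate u^-1 f u is killed
   on the right by 1 - e, hence e u^-1 f u is an idempotent of e S e. *)
Lemma corner_idempotent_lift e a :
    e * e = e -> e * a * e = a -> pi (a * a) = pi a ->
  exists f, [/\ f * f = f, e * f * e = f & pi f = pi a].
Proof.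
move=> ee eae /pi_lift [f [ff fa]].
have ae : a * e = a by rewrite -eae -mulrA ee.
pose u := 1 - f * (1 - e).
have u1 : pi u = 1.
  rewrite rmorphB rmorph1 rmorphM fa -rmorphM mulrBr mulr1 ae subrr.
  by rewrite rmorph0 subr0.
have [v [uv vu]] := unit_lift u1.
have fu : f * u = f * e.
  by rewrite mulrBr mulr1 mulrA ff mulrBr mulr1 opprB addrC subrK.
pose f' := v * (f * u).
have f'e : f' * e = f' by rewrite /f' fu -!mulrA ee.
have f'f' : f' * f' = f'.
  by rewrite /f' -!mulrA (mulrA u v) uv mul1r (mulrA f f) ff.
have v1 : pi v = 1 by rewrite -[LHS]mulr1 -u1 -rmorphM vu rmorph1.
exists (e * f'); split.
- by rewrite mulrA -(mulrA e f' e) f'e -mulrA f'f'.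
- by rewrite mulrA ee -mulrA f'e.
- rewrite -eae rmorphM /f' fu rmorphM v1 mul1r rmorphM fa -!rmorphM.
  by rewrite mulrA eae.
Qed.

(** How basicness enters: the e_i S are indecomposable and pairwise non-isomorphic right ideals. The
    x and y of [e_noniso] are mutually inverse isomorphisms between e_i S and e_j S. *)
Variables (I : finType) (e : I -> S).
Hypothesis e_idem : forall i, e i * e i = e i.
Hypothesis e_sum : \sum_i e i = 1.
Hypothesis e_neq0 : forall i, e i <> 0.
Hypothesis e_prim :
  forall i f, f * f = f -> e i * f * e i = f -> f = 0 \/ f = e i.
Hypothesis e_noniso : forall i j x y, e i * x * e j = x -> e j * y * e i = y ->
  x * y = e i -> y * x = e j -> i = j.

(** Regularity gives q with xq idempotent modulo the kernel. Its lift to e_i S e_i is nonzero, hence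
    equal to e_i, so xq agrees with e_i modulo the kernel and a unit corrects it to e_i. Then yx is
    a nonzero idempotent of e_j S e_j, that is, e_j. *)
Lemma corner_inverse i j x : e i * x * e j = x -> pi x <> 0 ->
  exists y, [/\ e j * y * e i = y, x * y = e i & y * x = e j].
Proof.
move=> exe x0; have [q0 xqx] := pi_regular x.
pose q := e j * q0 * e i.
have ex : e i * x = x by rewrite -exe !mulrA e_idem.
have xe : x * e j = x by rewrite -exe -!mulrA e_idem.
have qe : q * e i = q by rewrite -mulrA e_idem.
have eq : e j * q = q by rewrite !mulrA e_idem.
have xq0 : x * q * x = x * q0 * x.
  by rewrite /q !mulrA xe -!mulrA ex.
clearbody q.
have aa : pi (x * q * (x * q)) = pi (x * q).
  by rewrite mulrA xq0 rmorphM xqx rmorphM.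
have eae : e i * (x * q) * e i = x * q by rewrite mulrA ex -mulrA qe.
have [f [ff efe fa]] := corner_idempotent_lift (e_idem i) eae aa.
have [f0|fe] := e_prim ff efe.
  by case: x0; rewrite -xqx -xq0 rmorphM -fa f0 rmorph0 mul0r.
pose u := 1 - (e i - x * q).
have [|v [uv vu]] := @unit_lift u.
  by rewrite rmorphB rmorph1 rmorphB -fa fe subrr subr0.
have eu : e i * u = x * q.
  by rewrite mulrBr mulr1 mulrBr e_idem mulrA ex opprB addrC subrK.
clearbody u; pose y := q * v * e i.
have xy : x * y = e i by rewrite !mulrA -eu -(mulrA (e i)) uv mulr1 e_idem.
have ye : y * e i = y by rewrite -mulrA e_idem.
have ey : e j * y = y by rewrite !mulrA eq.
have eye : e j * y * e i = y by rewrite ey.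
clearbody y.
exists y; split=> //.
case: (@e_prim j (y * x)) => [||yx0|//].
- by rewrite mulrA -(mulrA y) xy ye.
- by rewrite mulrA ey -mulrA xe.
by case: (@e_neq0 i); rewrite -e_idem -xy mulrA -(mulrA x) yx0 mulr0 mul0r.
Qed.

(** An element surviving [pi] would be an isomorphism between e_j S and e_i S. So the image of S is
    a product of division rings, the images of the corners e_i S e_i. *)
Lemma corner_ker i j x : i != j -> pi (e i * x * e j) = 0.
Proof.
move=> ij; apply: contrapT => x0.
have [||y [eye xy yx]] := @corner_inverse i j (e i * x * e j); [|exact: x0|].
  by rewrite !mulrA e_idem -!mulrA e_idem.
case/eqP: ij; apply: (e_noniso _ eye xy yx).
by rewrite !mulrA e_idem -!mulrA e_idem.
Qed.

Lemma pi_peirce x : pi x = \sum_i pi (e i * x * e i).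
Proof.
rewrite -[x in LHS]mul1r -[x in LHS]mulr1 -e_sum mulrA mulr_suml mulr_suml.
rewrite rmorph_sum; apply: eq_bigr => i _.
rewrite mulr_sumr rmorph_sum (bigD1 i) //= big1 ?addr0 // => j ji.
by rewrite corner_ker // eq_sym.
Qed.

(** As the trace is 1, each i has a k(i) whose diagonal entry survives in the corner of e_i, with a
    right inverse y_i there. Put e_i in place k(i) of the row and y_i in place k(i) of the column:
    mixed corners vanish modulo the kernel, so the product is a unit, and its inverse goes into the
    row. *)
Lemma basic_trace_unit (K : finType) (m : K -> K -> S) : \sum_k m k k = 1 ->
  exists s s' : K -> S, \sum_k \sum_l s k * m k l * s' l = 1.
Proof.
move=> m1.
have /choice [k kP] i : exists k, pi (e i * m k k * e i) <> 0.
  apply: contrapT => nk; apply: (@e_neq0 i); apply: idempotent_ker => //.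
  rewrite -[e i]e_idem -[X in X * _]mulr1 -m1 mulr_sumr mulr_suml rmorph_sum.
  by rewrite big1 // => k _; apply: contrapT => kP; apply: nk; exists k.
have /choice [y yP] i : exists y, e i * m (k i) (k i) * e i * y = e i
                         /\ e i * y * e i = y.
  have [||y [eye xy _]] := @corner_inverse i i (e i * m (k i) (k i) * e i);
    [|exact: kP|by exists y].
  by rewrite !mulrA e_idem -!mulrA e_idem.
pose u := \sum_i \sum_j e i * m (k i) (k j) * (e j * y j).
have ey i : e i * y i = y i by rewrite -[y i](yP i).2 !mulrA e_idem.
have [|v [uv vu]] := @unit_lift u.
  rewrite rmorph_sum -(rmorph1 pi) -e_sum rmorph_sum; apply: eq_bigr => i _.
  rewrite rmorph_sum (bigD1 i) //= big1 => [|j ji].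
    by rewrite addr0 !mulrA (yP i).1.
  by rewrite mulrA rmorphM corner_ker ?mul0r // eq_sym.
exists (fun l => v * \sum_(i | k i == l) e i).
exists (fun l => \sum_(j | k j == l) e j * y j).
rewrite -vu.
transitivity (v * \sum_a \sum_b (\sum_(i | k i == a) e i) * (m a b *
    \sum_(j | k j == b) e j * y j)).
  rewrite mulr_sumr; apply: eq_bigr => a _; rewrite mulr_sumr.
  by apply: eq_bigr => b _; rewrite !mulrA.
congr (_ * _); rewrite /u (partition_big k xpredT) //=; apply: eq_bigr => a _.
under eq_bigr => b _ do rewrite mulr_suml.
rewrite exchange_big /=; apply: eq_bigr => i /eqP ->.
rewrite [RHS](partition_big k xpredT) //=; apply: eq_bigr => b _.
by rewrite !mulr_sumr; apply: eq_bigr => j /eqP ->; rewrite !mulrA.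
Qed.

(** Modulo the kernel, b is a right inverse of a in each corner, a division ring, hence a two-sided
    one. Then 1 - ba is an idempotent of the kernel. *)
Lemma basic_dedekind_finite (a b : S) : a * b = 1 -> b * a = 1.
Proof.
move=> ab.
have piE x y i : pi (e i * (x * y) * e i) =
    pi (e i * x * e i) * pi (e i * y * e i).
  rewrite -rmorphM -[in LHS](mulr1 x) -e_sum mulr_sumr mulr_suml mulr_sumr.
  rewrite mulr_suml rmorph_sum (bigD1 i) //= big1 => [|j ji]; rewrite ?addr0.
    by rewrite !mulrA -(mulrA (e i * x) (e i) (e i)) e_idem.
  have -> : e i * (x * e j * y) * e i = e i * x * e j * (y * e i).
    by rewrite !mulrA.
  by rewrite rmorphM corner_ker ?mul0r // eq_sym.
have ba1 : pi (b * a) = 1.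
  rewrite pi_peirce -(rmorph1 pi) -e_sum rmorph_sum; apply: eq_bigr => i _.
  rewrite piE; have := piE a b i; rewrite ab mulr1 e_idem => abi.
  have [||y [eye _ ya]] := @corner_inverse i i (e i * a * e i).
  - by rewrite !mulrA e_idem -!mulrA e_idem.
  - move=> a0; apply: (@e_neq0 i); apply: idempotent_ker => //.
    by rewrite abi a0 mul0r.
  have -> : pi (e i * b * e i) = pi y.
    transitivity (pi (e i) * pi (e i * b * e i)).
      by rewrite -rmorphM !mulrA e_idem.
    rewrite -[X in pi X * _]ya [X in X * _]rmorphM -mulrA -abi -rmorphM.
    by rewrite -eye -mulrA e_idem.
  by rewrite -rmorphM ya.
apply/eqP; rewrite -subr_eq0 -oppr_eq0 opprB; apply/eqP.
apply: idempotent_ker; last by rewrite rmorphB rmorph1 ba1 subrr.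
by rewrite mulrBr mulr1 mulrBl mul1r mulrA -(mulrA b a) ab mulr1 subrr subr0.
Qed.

End PrimitiveIdempotents.

(** * Indecomposable summands of a basic ring *)

Section LinearMaps.
Variables (A : pzRingType) (U V : lmodType A).

Definition linear_fun (f : U -> V) (fL : linear f) : {linear U -> V} :=
  HB.pack f (GRing.isLinear.Build A U V *:%R f fL).

Lemma linear_funE f fL x : @linear_fun f fL x = f x.
Proof. by []. Qed.

End LinearMaps.

Section FixedSubmodule.
Variables (A : pzRingType) (M : lmodType A) (g : {linear M -> M}).

(** For an idempotent g this is the image of g, described by an equation. *)
Definition fixed : {pred M} := fun x => g x == x.

Lemma fixedE x : (x \in fixed) = (g x == x).
Proof. by []. Qed.

Fact fixed_closed : subsemimod_closed fixed.
Proof.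
split; first split.
- by rewrite fixedE linear0.
- by move=> x y; rewrite !fixedE linearD => /eqP -> /eqP ->.
- by move=> a x; rewrite !fixedE linearZ /= => /eqP ->.
Qed.

Record fixed_submodule : Type :=
  Fixed { fixed_val :> M; _ : fixed_val \in fixed }.

HB.instance Definition _ := [isSub for fixed_val].
HB.instance Definition _ := [Choice of fixed_submodule by <:].
HB.instance Definition _ :=
  GRing.SubChoice_isSubLmodule.Build A M fixed fixed_submodule fixed_closed.

Lemma fixed_valP (x : fixed_submodule) : g (val x) = val x.
Proof. exact/eqP/(valP x). Qed.

End FixedSubmodule.

(** M is the direct sum of the images of g and 1 - g. *)
Lemma indecomposable_idempotent (A : pzRingType) (M : lmodType A)
    (g : {linear M -> M}) : indecomposable M -> (forall x, g (g x) = g x) ->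
  (forall x, g x = 0) \/ (forall x, g x = x).
Proof.
move=> [_ Mind] gg.
have hL : linear (fun x => x - g x).
  by move=> a x y; rewrite linearP scalerBr addrACA opprD.
pose h := linear_fun hL.
have hh x : h (h x) = h x.
  by rewrite !linear_funE linearB gg subrr subr0.
have gh x : g (h x) = 0 by rewrite linear_funE linearB gg subrr.
have hg x : h (g x) = 0 by rewrite linear_funE gg subrr.
have fixg x : g x \in fixed g by rewrite fixedE gg.
have fixh x : h x \in fixed h by rewrite fixedE hh.
pose F x : fixed_submodule g * fixed_submodule h :=
  (Sub (g x) (fixg x), Sub (h x) (fixh x)).
have FL : linear F.
  move=> a x y; apply: injective_projections; apply: val_inj.
    by rewrite !linearP !SubK linearP.
  by rewrite !linearP !SubK linearP.
have /Mind [] : isomorphic M (fixed_submodule g * fixed_submodule h)%type.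
- exists (linear_fun FL); exists (fun u => val u.1 + val u.2) => [x|[u v]].
    by rewrite linear_funE /= addrC subrK.
  have gv : g (val v) = 0 by rewrite -[val v](fixed_valP v) gh.
  have hu : h (val u) = 0 by rewrite -[val u](fixed_valP u) hg.
  rewrite linear_funE; apply: injective_projections; apply: val_inj.
    by rewrite SubK linearD fixed_valP gv addr0.
  by rewrite SubK linearD hu add0r fixed_valP.
- move=> g0; left=> x; have := congr1 val (g0 (Sub (g x) (fixg x))).
  by rewrite SubK linear0.
- move=> h0; right=> x; have := congr1 val (h0 (Sub (h x) (fixh x))).
  by rewrite SubK linear0 linear_funE => /eqP; rewrite subr_eq0 => /eqP.
Qed.

Section Decomposition.
Variables (R : pzRingType) (I : finType) (P : I -> rmodType R).

Lemma regular_decomposition (m : I -> nat) : (forall i, m i = 1%N) ->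
  isomorphic (regular_rmod R)
    (dsum (fun i : I => {ffun 'I_(m i) -> P i} : rmodType R)) ->
  exists (r : forall i, {linear regular_rmod R -> P i})
         (j : forall i, {linear P i -> regular_rmod R}),
    (forall i x, r i (j i x) = x) /\ (forall x, x = \sum_i j i (r i x)).
Proof.
move=> m1 [f [g fK gK]].
have gL : linear g by apply: can2_linear fK gK.
(* [m i] is only provably equal to 1, so the single index is given a name. *)
have o i : 'I_(m i) by rewrite m1; exact: ord0.
have oE i (k : 'I_(m i)) : k = o i.
  by apply/val_inj; move: k (o i); rewrite m1 => k l; rewrite !ord1.
have rL i : linear (fun x => f x i (o i)).
  by move=> a x y; rewrite linearP !ffunE.
pose D := dsum (fun i : I => {ffun 'I_(m i) -> P i} : rmodType R).
pose inc i (x : P i) : D :=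
  [ffun k => [ffun => dfwith (fun k => 0 : P k) x k] : {ffun 'I_(m k) -> P k}].
have incL i : linear (@inc i).
  move=> a x y; apply/ffunP=> k; rewrite !ffunE.
  apply/ffunP => l; rewrite !ffunE.
  case: (eqVneq i k) l => [<- l|ik l]; first by rewrite !dfwith_in.
  by rewrite !dfwith_out // scaler0 addr0.
have jL i : linear (fun x => g (@inc i x)).
  by move=> a x y; rewrite incL gL.
exists (fun i => linear_fun (rL i)), (fun i => linear_fun (jL i)); split.
- by move=> i x; rewrite !linear_funE gK !ffunE dfwith_in.
- move=> x; rewrite -[LHS]fK; pose g' := linear_fun gL.
  rewrite -[g]/(g' : _ -> _) -linear_sum; congr (g' _).
  apply/ffunP => k; apply/ffunP => l; rewrite (oE k l).
  rewrite (big_morph (fun h : D => h k (o k)) (id1 := 0) (op1 := +%R)).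
  + rewrite (bigD1 k) //= big1 => [|i ik]; rewrite !ffunE ?dfwith_in ?addr0 //.
    by rewrite dfwith_out.
  + by move=> u v; rewrite !ffunE.
  + by rewrite !ffunE.
Qed.

End Decomposition.

Section LeftMultiplication.
Variables (S : pzRingType) (a : S).

Fact lmul_linear : linear (fun x : regular_rmod S => a * x : regular_rmod S).
Proof.
move=> c x y; rewrite mulrDr; congr (_ + _).
exact: (mulrA a (x : S) (c : S)).
Qed.

Definition lmul : {linear regular_rmod S -> regular_rmod S} :=
  linear_fun lmul_linear.

End LeftMultiplication.

Section BasicRing.
Variable S : pzRingType.
Hypothesis Sbasic : basic S.

(** e_i = j_i(r_i 1) is the i-th component of 1, and left multiplication by it is the projection j_i
    r_i. Corner elements thus induce maps between the P_i, which turns indecomposability and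
    non-isomorphism into the last two properties. *)
Let peirce : exists (Q : pzRingType) (pi : {rmorphism S -> Q})
    (I : finType) (e : I -> S),
  [/\ forall x, pi x = 0 -> exists y, (1 - x) * y = 1,
      forall x, exists y, pi (x * y * x) = pi x
    & forall a, pi (a * a) = pi a -> exists f, f * f = f /\ pi f = pi a] /\
  [/\ forall i, e i * e i = e i, \sum_i e i = 1, forall i, e i <> 0,
      forall i f, f * f = f -> e i * f * e i = f -> f = 0 \/ f = e i
    & forall i j x y, e i * x * e j = x -> e j * y * e i = y ->
        x * y = e i -> y * x = e j -> i = j].
Proof.
have [[[Q [pi [[piS piK] Qss _]]] lift] [t [P [m [[Pind Pinj _ _ Sdec] m1]]]]] :=
  Sbasic.
have [r [j [rj jr]]] := regular_decomposition m1 Sdec.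
have jM i (y : P i) (x : S) : (j i y : S) * x = j i ((x : S^c) *: y).
  by rewrite linearZ.
have rM i (y x : S) : r i (y * x) = (x : S^c) *: r i y by rewrite -linearZ.
pose e i : S := j i (r i 1).
have eM i x : e i * x = j i (r i x) by rewrite jM -rM mul1r.
have ee i : e i * e i = e i by rewrite eM rj.
exists Q, pi, 'I_t, e; split; split=> //.
- by move=> x /piK; exact: Jac_right_inverse.
- move=> x; have [q xqx] := semisimple_regular (pi x) Qss.
  by have [y yq] := piS q; exists y; rewrite !rmorphM yq.
- move=> a aa; have [|f [ff /piK fa]] := lift a.
    by apply/piK; rewrite rmorphB aa subrr.
  by exists f; split=> //; apply/eqP; rewrite -subr_eq0 -rmorphB fa.
- move=> i ei0; have [[[x]]] := Pind i; case/eqP.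
  rewrite -(rj i x) -[j i x](mul1r (j i x : S)) rM -(rj i (r i 1)) -/(e i).
  by rewrite ei0 linear0 scaler0.
- move=> i f ff efe.
  have fe : f * e i = f by rewrite -efe -mulrA ee.
  have ef : e i * f = f by rewrite -efe !mulrA ee.
  pose g : {linear P i -> P i} := r i \o (lmul f \o j i).
  have jg x : j i (g x) = f * j i x by rewrite /= -eM mulrA ef.
  have [Pi _ _] := Pind i.
  have [|g0|g1] := indecomposable_idempotent (g := g) Pi.
  + by move=> x; rewrite -(rj i (g _)) !jg -[RHS](rj i) jg mulrA ff.
  + by left; rewrite -fe /e -jg g0 linear0.
  + by right; rewrite -fe /e -jg g1.
- move=> i k x y exe eye xy yx; apply: Pinj.
  have ex : e i * x = x by rewrite -exe !mulrA ee.
  have ey : e k * y = y by rewrite -eye !mulrA ee.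
  exists (r k \o (lmul y \o j i)); exists (r i \o (lmul x \o j k)) => z /=.
  + by rewrite -eM mulrA -mulrA (mulrA (e k)) ey mulrA xy eM !rj.
  + by rewrite -eM mulrA -mulrA (mulrA (e i)) ex mulrA yx eM !rj.
Qed.

Lemma basic_trace (K : finType) (m : K -> K -> S) : \sum_k m k k = 1 ->
  exists s s' : K -> S, \sum_k \sum_l s k * m k l * s' l = 1.
Proof.
have [Q [pi [I [e [[rinv reg lift] [ee e1 e0 ep en]]]]]] := peirce.
exact: (basic_trace_unit rinv reg lift ee e1 e0 ep en).
Qed.

Lemma basic_dedekind (a b : S) : a * b = 1 -> b * a = 1.
Proof.
have [Q [pi [I [e [[rinv reg lift] [ee e1 e0 ep en]]]]]] := peirce.
exact: (basic_dedekind_finite rinv reg lift ee e1 e0 ep en).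
Qed.

End BasicRing.

(** * Dual bases and trace ideals *)

Section QuotientModule.
Variables (A : pzRingType) (M : lmodType A) (T : zmodClosed M).
Hypothesis TZ : scaler_closed T.
Local Open Scope quotient_scope.

(** The closure proof is an argument so that the module structure can be found from the type. *)
Definition quot_module of scaler_closed T : Type := Quotient.quot T.
Local Notation quot := (quot_module TZ).

HB.instance Definition _ := GRing.Zmodule.on quot.

Definition quot_pi (x : M) : quot := \pi_(Quotient.quot T) x.
Definition quot_scale (a : A) (x : quot) : quot :=
  quot_pi (a *: repr (x : Quotient.quot T)).

Lemma quot_piP (x : quot) : exists y, x = quot_pi y.
Proof. by exists (repr (x : Quotient.quot T)); rewrite /quot_pi reprK. Qed.

Lemma quot_piD x y : quot_pi (x + y) = quot_pi x + quot_pi y.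
Proof. by rewrite /quot_pi Quotient.pi_add. Qed.

Lemma quot_pi_eq x y : (quot_pi x == quot_pi y) = (x - y \in T).
Proof. by rewrite Quotient.idealrBE. Qed.

Lemma quot_scale_pi a x : quot_scale a (quot_pi x) = quot_pi (a *: x).
Proof.
apply/eqP; rewrite quot_pi_eq -scalerBr; apply: TZ.
by rewrite -quot_pi_eq /quot_pi reprK.
Qed.

Fact quot_scaleA a b x : quot_scale a (quot_scale b x) = quot_scale (a * b) x.
Proof. by have [y ->] := quot_piP x; rewrite !quot_scale_pi scalerA. Qed.
Fact quot_scale1 : left_id 1 quot_scale.
Proof.
by move=> x; have [y ->] := quot_piP x; rewrite quot_scale_pi scale1r.
Qed.
Fact quot_scaleDr : right_distributive quot_scale +%R.
Proof.
move=> a x y; have [[u ->] [v ->]] := (quot_piP x, quot_piP y).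
by rewrite -quot_piD !quot_scale_pi scalerDr quot_piD.
Qed.
Fact quot_scaleDl x : {morph quot_scale^~ x : a b / a + b}.
Proof.
move=> a b; have [u ->] := quot_piP x.
by rewrite !quot_scale_pi scalerDl quot_piD.
Qed.

HB.instance Definition _ := GRing.Zmodule_isLmodule.Build A quot
  quot_scaleA quot_scale1 quot_scaleDr quot_scaleDl.

Fact quot_pi_linear : linear quot_pi.
Proof. by move=> a x y; rewrite quot_piD -quot_scale_pi. Qed.

End QuotientModule.

Section ProgeneratorFamilies.
Variables (A : pzRingType) (P : lmodType A).

(** Projectivity splits the surjection from A^n given by the generators; [psi] consists of the
    coordinates of the splitting. *)
Lemma dual_basis : finitely_generated P -> projective P ->
  exists n (x : 'I_n -> P) (psi : 'I_n -> {linear P -> A^o}),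
    forall y, y = \sum_i (psi i y : A) *: x i.
Proof.
move=> [n [x xgen]] /(_ {ffun 'I_n -> A^o} P) proj.
have gL : linear (fun a : {ffun 'I_n -> A^o} => \sum_i (a i : A) *: x i).
  move=> c a b; rewrite scaler_sumr -big_split; apply: eq_bigr => i _.
  by rewrite !ffunE scalerDl scalerA.
have [|h hP] := proj (linear_fun gL) idfun.
  by move=> y; have [a ->] := xgen y; exists [ffun i => a i];
     apply: eq_bigr => i _; rewrite ffunE.
have psiL i : linear (fun y => h y i : A^o).
  by move=> c y z; rewrite linearP !ffunE.
by exists n, x, (fun i => linear_fun (psiL i)) => y; rewrite -[LHS]hP.
Qed.

Let trace_ideal : {pred A^o} := fun a =>
  `[< exists s : seq ({linear P -> A^o} * P), a = \sum_(u <- s) u.1 u.2 >].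

Let trace_zmod_closed : zmod_closed trace_ideal.
Proof.
split=> [|a b /asboolP [s ->] /asboolP [t ->]]; apply/asboolP.
  by exists [::]; rewrite big_nil.
exists (s ++ [seq (u.1, - u.2) | u <- t]).
rewrite big_cat big_map /= -sumrN; congr (_ + _).
by apply: eq_bigr => u _; rewrite linearN.
Qed.

Let trace_scaler_closed : scaler_closed trace_ideal.
Proof.
move=> c a /asboolP [s ->]; apply/asboolP.
exists [seq (u.1, c *: u.2) | u <- s]; rewrite big_map scaler_sumr.
by apply: eq_bigr => u _; rewrite linearZ.
Qed.

(* Otherwise the projection onto the quotient by the trace ideal is a nonzero
   map killed by all maps P -> A. *)
Lemma generator_trace : generator P ->
  exists n (phi : 'I_n -> {linear P -> A^o}) (p : 'I_n -> P),
    \sum_i phi i (p i) = 1.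
Proof.
pose T : zmodClosed A^o :=
  HB.pack trace_ideal
    (GRing.isZmodClosed.Build A^o trace_ideal trace_zmod_closed).
have TZ : scaler_closed T := trace_scaler_closed.
have zL : linear (fun _ : A^o => 0 : quot_module TZ).
  by move=> a x y; rewrite scaler0 addr0.
move=> /(_ A^o (quot_module TZ) (linear_fun (quot_pi_linear TZ))
        (linear_fun zL)) Pgen.
have /asboolP [s s1] : (1 : A^o) \in trace_ideal.
  rewrite -[1]subr0 -[_ \in _](quot_pi_eq TZ); apply/eqP.
  rewrite -[LHS](linear_funE (quot_pi_linear TZ)) Pgen.
    by rewrite linear_funE -[RHS](linear_funE (quot_pi_linear TZ)) linear0.
  move=> h x; rewrite /= -[RHS](linear0 (linear_fun (quot_pi_linear TZ))).
  apply/eqP; rewrite linear_funE quot_pi_eq subr0; apply/asboolP.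
  by exists [:: (h, x)]; rewrite big_seq1.
exists (size s), (fun i => (tnth (in_tuple s) i).1),
  (fun i => (tnth (in_tuple s) i).2).
by rewrite [RHS]s1 [RHS]big_tnth.
Qed.

End ProgeneratorFamilies.

(** * Bimodules inducing the full endomorphism ring *)

(** Written separately so that scalars multiply in R and not in its converse. *)
Definition rscale (R : pzRingType) (M : rmodType R) (x : M) (r : R) : M :=
  (r : R^c) *: x.
Local Notation "x ** r" := (rscale x r) (at level 40, left associativity).

Section RightScaling.
Variables (R : pzRingType) (M : rmodType R).
Implicit Types (x y : M) (r s : R).

Lemma rscaleA x r s : x ** r ** s = x ** (r * s).
Proof. exact: scalerA. Qed.
Lemma rscale1 x : x ** 1 = x.
Proof. exact: scale1r. Qed.
Lemma rscale0 x : x ** 0 = 0.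
Proof. exact: scale0r. Qed.
Lemma rscaleDr x r s : x ** (r + s) = x ** r + x ** s.
Proof. exact: scalerDl. Qed.
Lemma rscale_sum (I : finType) x (F : I -> R) :
  x ** (\sum_i F i) = \sum_i x ** F i.
Proof. exact: (big_morph _ (rscaleDr x) (rscale0 x)). Qed.

Lemma linear_rscale (N : rmodType R) (f : {linear M -> N}) x r :
  f (x ** r) = f x ** r.
Proof. exact: linearZ. Qed.

Lemma rscale_linear (N : rmodType R) (f : M -> N) :
  {morph f : x y / x + y} -> (forall x r, f (x ** r) = f x ** r) -> linear f.
Proof. by move=> fD fZ r x y; rewrite fD; congr (_ + _); exact: fZ. Qed.

(** An element of Hom(M, R), as a plain map so that its values multiply in R. *)
Definition functional (f : M -> R) : Prop :=
  {morph f : x y / x + y} /\ forall x r, f (x ** r) = f x * r.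

Lemma functional_sum f (I : finType) (F : I -> M) :
  functional f -> f (\sum_i F i) = \sum_i f (F i).
Proof.
move=> [fD fZ]; apply: (big_morph _ fD).
by rewrite -(rscale0 0) fZ mulr0.
Qed.

Lemma linear_functional (f : {linear M -> regular_rmod R}) : functional f.
Proof. by split=> [x y|x r]; [rewrite linearD|rewrite [LHS]linearZ]. Qed.

Definition dual_basis_of (I : finType) (x : I -> M) (psi : I -> M -> R) :=
  (forall i, functional (psi i)) /\ forall y, y = \sum_i x i ** psi i y.

Definition trace_one (I : finType) (phi : I -> M -> R) (p : I -> M) :=
  (forall i, functional (phi i)) /\ \sum_i phi i (p i) = 1.

End RightScaling.

Section Endomorphisms.
Variables (R E : pzRingType) (V : rmodType R) (act : E -> {linear V -> V}).

(** The condition E = End(V), shared by S on P and the matrix ring on P^n. *)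
Definition acts_as_End : Prop :=
  bimodule act /\
  forall f : {linear V -> V}, exists! s : E, forall x, f x = act s x.

Hypothesis actE : acts_as_End.

Lemma act1 x : act 1 x = x.
Proof. by have [[]] := actE. Qed.
Lemma actD s t x : act (s + t) x = act s x + act t x.
Proof. by have [[]] := actE. Qed.
Lemma actM s t x : act (s * t) x = act s (act t x).
Proof. by have [[]] := actE. Qed.
Lemma act0 x : act 0 x = 0.
Proof. by apply: (addrI (act 0 x)); rewrite -actD !addr0. Qed.
Lemma act_sum (I : finType) (F : I -> E) x :
  act (\sum_i F i) x = \sum_i act (F i) x.
Proof. exact: (big_morph (act^~ x) (fun s t => actD s t x) (act0 x)). Qed.

Lemma act_full (f : V -> V) : linear f -> exists s, forall x, act s x = f x.
Proof.
move=> fL; have [s [fs _]] := actE.2 (linear_fun fL).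
by exists s => x; rewrite -fs.
Qed.

Lemma act_faithful s t : (forall x, act s x = act t x) -> s = t.
Proof.
move=> st; have [u [_ uP]] := actE.2 (act s).
by rewrite -(uP s) // -(uP t).
Qed.

Section Center.
Variables (I : finType) (phi : I -> V -> R) (p : I -> V).
Hypothesis tr : trace_one phi p.

(** Since 1 = sum_i phi_i(p_i), the scalar c = sum_i phi_i(p_i c) is determined by its action. *)
Lemma rscale_faithful c d : (forall x : V, x ** c = x ** d) -> c = d.
Proof.
have [phiP tr1] := tr; move=> cd.
rewrite -[c]mul1r -[d]mul1r -tr1 !mulr_suml; apply: eq_bigr => i _.
by rewrite -!(phiP i).2 cd.
Qed.

(* The endomorphisms x |-> p phi(x) force a central z to act as right
   multiplication by sum_i phi_i(z p_i). *)
Lemma center_End (z : E) : z \in center (R := E) ->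
  exists c, c \in center (R := R) /\ forall x, act z x = x ** c.
Proof.
move=> /centerP zC; have [phiP tr1] := tr.
pose c := \sum_i phi i (act z (p i)).
have zc x : act z x = x ** c.
  rewrite -{1}[x]rscale1 -tr1 !rscale_sum linear_sum; apply: eq_bigr => i _.
  have fL : linear (fun y => x ** phi i y).
    apply: rscale_linear => [u v|u r]; first by rewrite (phiP i).1 rscaleDr.
    by rewrite (phiP i).2 rscaleA.
  by have [s sP] := act_full fL; rewrite -!sP -!actM zC.
exists c; split=> //; apply/centerP => r; apply: rscale_faithful => x.
by rewrite -!rscaleA -!zc linear_rscale.
Qed.

End Center.
End Endomorphisms.

(** * Sesquilinear forms and adjoints *)

Section Forms.
Variables (R : pzRingType) (al : R -> R).
Hypothesis alD : {morph al : x y / x + y}.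
Hypothesis alM : forall x y, al (x * y) = al y * al x.
Hypothesis alK : involutive al.

Let al1 : al 1 = 1.
Proof. by rewrite -[RHS]alK -[al 1 in RHS]mulr1 alM alK mulr1. Qed.

Let al_sum (I : finType) (F : I -> R) : al (\sum_i F i) = \sum_i al (F i).
Proof.
apply: (big_morph _ alD); apply: (addrI (al 0)).
by rewrite -alD !addr0.
Qed.

(** Equivalently, x |-> b(x, -) is right linear from V to its dual, on which r acts by f |-> al(r)
    f. *)
Definition sesquilinear (V : rmodType R) (b : V -> V -> R) : Prop :=
  [/\ forall x, functional (b x),
      forall x y z, b (x + y) z = b x z + b y z
    & forall x r y, b (x ** r) y = al r * b x y].

Lemma sesquilinear_flip (V : rmodType R) (b : V -> V -> R) :
  sesquilinear b -> sesquilinear (fun x y => al (b y x)).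
Proof.
move=> [bF bD bZ]; split=> [x|x y z|x r y].
- by split=> [y z|y r]; rewrite ?bD ?alD // bZ alM alK.
- by rewrite (bF z).1 alD.
- by rewrite (bF y).2 alM.
Qed.

Lemma sesquilinear_suml (V : rmodType R) (b : V -> V -> R) (I : finType)
  (F : I -> V) y : sesquilinear b -> b (\sum_i F i) y = \sum_i b (F i) y.
Proof.
move=> bS; have [fF _ _] := sesquilinear_flip bS.
rewrite -[LHS]alK (functional_sum _ (fF y)).
by rewrite al_sum; apply: eq_bigr => i _; rewrite alK.
Qed.

Section Adjoint.
Variables (E : pzRingType) (V : rmodType R) (act : E -> {linear V -> V}).
Hypothesis actE : acts_as_End act.
Variables (h : V -> V -> R) (I : finType) (w z : I -> V).
Hypothesis hS : sesquilinear h.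
Hypothesis h_herm : forall x y, h y x = al (h x y).
(** Regularity of h through explicit dual bases: the z_i with the functionals h(w_i, -), then the
    w_i with h(z_i, -). *)
Hypothesis hz : forall y, y = \sum_i z i ** h (w i) y.
Hypothesis hw : forall y, y = \sum_i w i ** h (z i) y.

Lemma form_faithful s t : (forall x y, h x (act s y) = h x (act t y)) -> s = t.
Proof.
move=> st; apply: (act_faithful actE) => y; rewrite [LHS]hz [RHS]hz.
by apply: eq_bigr => i _; rewrite st.
Qed.

Lemma adjoint_exists s : exists t, forall x y, h (act s x) y = h x (act t y).
Proof.
have [hF hD hZ] := hS.
(* The only candidate for t: expand t y by [hz] and replace h(w_i, t y) by h(s w_i, y). *)
have fL : linear (fun y => \sum_i z i ** h (act s (w i)) y).
  apply: rscale_linear => [x y|x r].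
    rewrite -big_split; apply: eq_bigr => i _.
    by rewrite (hF _).1 rscaleDr.
  rewrite /rscale scaler_sumr; apply: eq_bigr => i _.
  by rewrite (hF _).2 -/(rscale _ _) -rscaleA.
have [t tP] := act_full actE fL; exists t => x y.
rewrite tP (functional_sum _ (hF x)) {1}[x]hw linear_sum.
rewrite (sesquilinear_suml _ _ hS); apply: eq_bigr => i _.
by rewrite (hF x).2 linear_rscale hZ -h_herm.
Qed.

(** Adjoints reverse products, whence the target [E^c]. Each law is checked after pairing with h;
    hermitian symmetry makes the double adjoint the identity. *)
Lemma adjoint_involution : exists beta : {rmorphism E -> E^c},
  involution beta /\ forall s x y, h (act s x) y = h x (act (beta s : E) y).
Proof.
have [hF hD hZ] := hS.
have /choice [adj adjP] := adjoint_exists.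
have adjB : zmod_morphism (adj : E -> E^c).
  move=> s t; apply: form_faithful => x y.
  have actB u v (p : V) : act (u - v) p = act u p - act v p.
    by apply/eqP; rewrite eq_sym subr_eq -(actD actE) subrK.
  have hBr u v p : h u (v - p) = h u v - h u p.
    by apply/eqP; rewrite eq_sym subr_eq -(hF u).1 subrK.
  have hBl u v p : h (u - v) p = h u p - h v p.
    by apply/eqP; rewrite eq_sym subr_eq -hD subrK.
  by rewrite -adjP !actB hBl hBr !adjP.
have adjM : monoid_morphism (adj : E -> E^c).
  split=> [|s t]; apply: form_faithful => x y.
    by rewrite -adjP !(act1 actE).
  by rewrite -adjP !(actM actE) !adjP.
pose beta : {rmorphism E -> E^c} := HB.pack (adj : E -> E^c)
  (GRing.isZmodMorphism.Build E E^c adj adjB)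
  (GRing.isMonoidMorphism.Build E E^c adj adjM).
exists beta; split=> // s; apply: form_faithful => x y.
by rewrite -[beta (beta s)]/(adj (adj s)) -adjP h_herm -adjP -h_herm.
Qed.

End Adjoint.

(** * Existence of a regular sesquilinear form on P *)

Section Existence.
Variables (S : pzRingType) (P : rmodType R) (act : S -> {linear P -> P}).
Hypothesis actE : acts_as_End act.
Hypothesis S_trace : forall (K : finType) (m : K -> K -> S),
  \sum_k m k k = 1 ->
  exists s s' : K -> S, \sum_k \sum_l s k * m k l * s' l = 1.
Hypothesis S_dedekind : forall s t : S, s * t = 1 -> t * s = 1.
Variables (I J : finType) (x : I -> P) (psi : I -> P -> R).
Variables (phi : J -> P -> R) (p : J -> P).
Hypothesis xpsi : dual_basis_of x psi.
Hypothesis trp : trace_one phi p.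

(* The form b is a map from P to its dual, and (p', q') defines a right inverse
   f |-> sum_l p'_l al(f(q'_l)) to it. *)
Lemma split_form : exists (b : P -> P -> R) (L : finType) (p' q' : L -> P),
  sesquilinear b /\ forall y, y = \sum_l q' l ** b (p' l) y.
Proof.
have [[psiF xb] [phiF tr1]] := (xpsi, trp).
pose b0 (u : I * J) y z := al (phi u.2 y) * psi u.1 z.
have b0S u : sesquilinear (b0 u).
  split=> [y|y y' z|y r z]; first split=> [z z'|z r].
  - by rewrite /b0 (psiF _).1 mulrDr.
  - by rewrite /b0 (psiF _).2 mulrA.
  - by rewrite /b0 (phiF _).1 alD mulrDl.
  - by rewrite /b0 (phiF _).2 alM mulrA.
(* Precomposition with m(u, v) on the dual of P is the composite of f |-> p_j al(f(x_i)), where u =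
   (i, j), with the map back to the dual given by [b0 v]. *)
have mex (uv : (I * J) * (I * J)) : exists s, forall y,
    act s y = x uv.1.1 ** b0 uv.2 (p uv.1.2) y.
  apply: (act_full actE); have [bF _ _] := b0S uv.2.
  apply: rscale_linear => [y z|y r]; first by rewrite (bF _).1 rscaleDr.
  by rewrite (bF _).2 rscaleA.
have [m mP] := choice mex.
(* The trace is 1 because sum_j phi_j(p_j) = 1 and x, psi form a dual basis. *)
have [|s [s' ss']] := S_trace (m := fun u v => m (u, v)).
  apply: (act_faithful actE) => y; rewrite (act_sum actE) (act1 actE) [RHS]xb.
  transitivity (\sum_i \sum_j x i ** (al (phi j (p j)) * psi i y)).
    by rewrite pair_bigA; apply: eq_bigr => u _; rewrite mP.
  apply: eq_bigr => i _; rewrite -[in RHS](mul1r (psi i y)) -al1 -tr1 al_sum.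
  by rewrite mulr_suml rscale_sum.
(* The column s' is absorbed into the second argument of b, the row s into q'. *)
exists (fun y z => \sum_v b0 v y (act (s' v) z)), (I * J)%type,
  (fun u => p u.2), (fun u => act (s u) (x u.1)); split.
  split=> [y|y y' z|y r z]; first split=> [z z'|z r].
  - rewrite -big_split; apply: eq_bigr => v _; have [bF _ _] := b0S v.
    by rewrite linearD (bF _).1.
  - rewrite mulr_suml; apply: eq_bigr => v _; have [bF _ _] := b0S v.
    by rewrite linear_rscale (bF _).2.
  - by rewrite -big_split; apply: eq_bigr => v _; have [_ -> _] := b0S v.
  - by rewrite mulr_sumr; apply: eq_bigr => v _; have [_ _ ->] := b0S v.
move=> y; rewrite -[LHS](act1 actE) -ss' (act_sum actE); apply: eq_bigr => u _.
rewrite (act_sum actE) rscale_sum; apply: eq_bigr => v _.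
by rewrite !(actM actE) mP linear_rscale.
Qed.

(** The first expansion makes f |-> sum_l p'_l al(f(q'_l)) a right inverse of y |-> b(y, -), the
    second a left inverse. *)
Lemma regular_form : exists (b : P -> P -> R) (L : finType) (p' q' : L -> P),
  [/\ sesquilinear b, forall y, y = \sum_l q' l ** b (p' l) y
    & forall y, y = \sum_l p' l ** al (b y (q' l))].
Proof.
have [b [L [p' [q' [bS bq]]]]] := split_form.
have [bF bD bZ] := bS; have [fF fD fZ] := sesquilinear_flip bS.
have familyL (u v : L -> P) (f : P -> P -> R) : (forall y, functional (f y)) ->
    linear (fun y => \sum_l u l ** f (v l) y).
  move=> fF'; apply: rscale_linear => [y z|y r].
    by rewrite -big_split; apply: eq_bigr => l _; rewrite (fF' _).1 rscaleDr.
  rewrite /rscale scaler_sumr; apply: eq_bigr => l _.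
  by rewrite (fF' _).2 -/(rscale _ _) -rscaleA.
(* c is the asymmetry of b, b(c y, z) = al(b(z, y)), while d y depends only on b(y, -). Dedekind
   finiteness turns dc = 1 into cd = 1, so d is injective, and hence y |-> b(y, -) is. *)
have [c cP] := act_full actE (familyL p' q' _ bF).
have [d dP] := act_full actE (familyL q' p' _ fF).
have dc : d * c = 1.
  apply: (act_faithful actE) => y; rewrite (actM actE) (act1 actE) dP.
  rewrite [RHS]bq; apply: eq_bigr => l _; congr (_ ** _).
  rewrite cP (sesquilinear_suml _ _ bS) -[RHS]alK [in RHS](bq (p' l)).
  congr al; rewrite (functional_sum _ (fF y)); apply: eq_bigr => k _.
  by rewrite bZ (fF y).2.
have d_inj y z : act d y = act d z -> y = z.
  by move=> yz; rewrite -[y](act1 actE) -[z](act1 actE) -(S_dedekind dc)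
    !(actM actE) yz.
exists b, L, p', q'; split=> // y; apply: d_inj; rewrite !dP.
apply: eq_bigr => l _; congr (_ ** al _).
rewrite (sesquilinear_suml _ _ bS) {1}[p' l]bq (functional_sum _ (bF y)).
by apply: eq_bigr => k _; rewrite (bF y).2 bZ alK.
Qed.

End Existence.
End Forms.

(** * The matrix ring acting on P^n *)

Section MatrixAction.
Variables (R S : pzRingType) (P : rmodType R) (act : S -> {linear P -> P}).
Variable n : nat.
Hypothesis actE : acts_as_End act.

Local Notation V := ({ffun 'I_n -> P} : rmodType R).

Fact mx_act_linear (A : 'M[S]_n) :
  linear (fun v : V => [ffun i => \sum_j act (A i j) (v j)] : V).
Proof.
move=> r u v; apply/ffunP => i; rewrite !ffunE scaler_sumr -big_split.
by apply: eq_bigr => j _; rewrite !ffunE linearP.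
Qed.

Definition mx_act (A : 'M[S]_n) : {linear V -> V} :=
  linear_fun (mx_act_linear A).

Lemma mx_actE A v i : mx_act A v i = \sum_j act (A i j) (v j).
Proof. by rewrite ffunE. Qed.

Lemma mx_act_scalar s v i : mx_act s%:M v i = act s (v i).
Proof.
rewrite mx_actE (bigD1 i) //= big1 => [|j /negPf ji]; rewrite !mxE.
  by rewrite eqxx mulr1n addr0.
by rewrite eq_sym ji mulr0n (act0 actE).
Qed.

Definition unit_vector (j : 'I_n) (x : P) : V :=
  [ffun i => if i == j then x else 0].

Lemma unit_vector_linear j : linear (unit_vector j).
Proof.
move=> a x y; apply/ffunP => i; rewrite !ffunE; case: ifP => // _.
by rewrite scaler0 addr0.
Qed.

Lemma unit_vector_sum (v : V) : v = \sum_j unit_vector j (v j).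
Proof.
apply/ffunP => i; rewrite sum_ffunE (bigD1 i) //= big1 => [|j /negPf ji].
  by rewrite addr0 ffunE eqxx.
by rewrite ffunE eq_sym ji.
Qed.

Lemma mx_act_unit A i j x : mx_act A (unit_vector j x) i = act (A i j) x.
Proof.
rewrite mx_actE (bigD1 j) //= big1 => [|k /negPf kj].
  by rewrite addr0 ffunE eqxx.
by rewrite ffunE kj linear0.
Qed.

(** The (i, j) entry is the element of S acting as the component of f from copy j to copy i. *)
Lemma mx_acts_as_End : acts_as_End mx_act.
Proof.
split; first split=> [v|A B v|A B v].
- by apply/ffunP => i; rewrite mx_act_scalar (act1 actE).
- apply/ffunP => i; rewrite mx_actE ffunE !mx_actE -big_split.
  by apply: eq_bigr => j _; rewrite mxE (actD actE).
- apply/ffunP => i; rewrite !mx_actE.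
  under [RHS]eq_bigr => j _ do rewrite mx_actE linear_sum.
  rewrite exchange_big /=; apply: eq_bigr => k _.
  by rewrite mxE (act_sum actE); apply: eq_bigr => j _; rewrite (actM actE).
move=> f.
have entry (u : 'I_n * 'I_n) : exists s, forall x,
    act s x = f (unit_vector u.2 x) u.1.
  apply: (act_full actE) => a x y.
  by rewrite unit_vector_linear linearP !ffunE.
have [m mP] := choice entry.
exists (\matrix_(i, j) m (i, j)); split=> [v|A fA].
  apply/ffunP => i; rewrite mx_actE {1}[v]unit_vector_sum linear_sum sum_ffunE.
  by apply: eq_bigr => j _; rewrite mxE mP.
apply/matrixP => i j; rewrite mxE; apply: (act_faithful actE) => x.
by rewrite mP fA mx_act_unit.
Qed.

End MatrixAction.

(** * The hermitian form on P^2 and its adjoint involution *)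

Theorem proposition6p2 (R : pzRingType) (S : calgType (Cent R))
    (sigma : {rmorphism Cent R -> Cent R}) :
  semiperfect R ->
  basic S ->
  morita_equivalent (Cent_alg R) S ->
  bijective sigma ->
  has_involution_of_type (Cent_alg R) sigma ->
  has_involution_of_type (mx_alg 2 S) sigma.
Proof.
move=> _ Sbasic [P [act [[actB Pfg Pproj Pgen actEnd] actC]]] _.
move=> [_ [alpha [alphaK alphaC]]].
pose al (r : R) : R := alpha r.
have alD : {morph al : x y / x + y} by move=> x y; rewrite /al rmorphD.
have alM x y : al (x * y) = al y * al x by rewrite /al rmorphM.
have alK : involutive al := alphaK.
have actE : acts_as_End act by split.
have [n [x [psi xpsi]]] := dual_basis Pfg Pproj.
have [k [phi [p trp]]] := generator_trace Pgen.
have dbP : dual_basis_of (R := R) x (fun i => psi i : P -> R).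
  by split=> [i|//]; exact: linear_functional.
have trP : trace_one (R := R) (fun i => phi i : P -> R) p.
  by split=> [i|//]; exact: linear_functional.
have [b [L [p' [q' [bS bq bp]]]]] := regular_form alD alM alK actE
  (basic_trace Sbasic) (basic_dedekind Sbasic) dbP trP.
have [bF bD bZ] := bS.
pose V : rmodType R := {ffun 'I_2 -> P}.
pose E := mx_act act (n := 2).
have EE : acts_as_End E := mx_acts_as_End 2 actE.
(* Only coordinate 0 of the constant vectors is read. *)
have trV : trace_one (fun i (v : V) => phi i (v ord0) : R)
    (fun i => [ffun=> p i]).
  split=> [i|]; last by rewrite -[RHS]trp; apply: eq_bigr => i _; rewrite ffunE.
  have [fD fZ] := linear_functional (phi i).
  by split=> [u v|u r]; rewrite ffunE; [exact: fD|exact: fZ].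
have VZ (v : V) r i : rscale v r i = rscale (v i) r by rewrite ffunE.
have EC (c : Cent R) (v : V) : E (calg_map (mx_alg 2 S) c) v = rscale v (val c).
  apply/ffunP => i; rewrite VZ.
  transitivity (act (calg_map S c) (v i)); last exact: actC.
  exact: (mx_act_scalar actE).
pose h (u v : V) : R := b (u ord0) (v ord_max) + al (b (v ord0) (u ord_max)).
have hS : sesquilinear al h.
  split=> [u|u u' v|u r v]; first split=> [v v'|v r]; rewrite /h.
  - by rewrite !ffunE (bF _).1 bD alD addrACA.
  - by rewrite !VZ (bF _).2 bZ alM alK mulrDl.
  - by rewrite !ffunE (bF _).1 bD alD addrACA.
  - by rewrite !VZ (bF _).2 bZ alM mulrDr.
have h_herm u v : h v u = al (h u v).
  by rewrite /h alD alK addrC.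
(* Both copies of P are totally isotropic for h, which pairs one with the other; [bq] and [bp] each
   expand one coordinate. z is w with the two summands of [L + L] exchanged. *)
pose w (l : L + L) : V :=
  match l with
  | inl l => unit_vector ord0 (p' l)
  | inr l => unit_vector ord_max (q' l)
  end.
pose z (l : L + L) : V :=
  match l with
  | inl l => unit_vector ord_max (q' l)
  | inr l => unit_vector ord0 (p' l)
  end.
have al0 : al 0 = 0 by rewrite /al rmorph0.
have b0r y : b y 0 = 0 by rewrite -(rscale0 0) (bF y).2 mulr0.
have b0l y : b 0 y = 0 by rewrite -(rscale0 0) bZ al0 mul0r.
have decV (v : V) :
    v = unit_vector ord0 (v ord0) + unit_vector ord_max (v ord_max).
  by rewrite [LHS]unit_vector_sum big_ord_recl big_ord1; congr (_ + _);
    have -> : lift ord0 ord0 = ord_max :> 'I_2 by exact: val_inj.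
have unitD (I : finType) j (F : I -> P) :
    unit_vector j (\sum_i F i) = \sum_i unit_vector j (F i) :> V.
  exact: (linear_sum (linear_fun (@unit_vector_linear R P 2 j))).
have unitZ j y r : unit_vector j (rscale y r) = rscale (unit_vector j y) r :> V.
  exact: (linear_rscale (linear_fun (@unit_vector_linear R P 2 j))).
have unit00 y : (unit_vector ord0 y : V) ord0 = y by rewrite ffunE.
have unit01 y : (unit_vector ord0 y : V) ord_max = 0 by rewrite ffunE.
have unit10 y : (unit_vector ord_max y : V) ord0 = 0 by rewrite ffunE.
have unit11 y : (unit_vector ord_max y : V) ord_max = y by rewrite ffunE.
have hz v : v = \sum_l rscale (z l) (h (w l) v).
  rewrite big_sumType /= /h.
  under eq_bigr do rewrite unit00 unit01 b0r al0 addr0 -unitZ.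
  under [X in _ + X]eq_bigr do rewrite unit10 unit11 b0l add0r -unitZ.
  by rewrite -!unitD -bq -bp addrC -decV.
have hw v : v = \sum_l rscale (w l) (h (z l) v).
  rewrite big_sumType /= /h.
  under eq_bigr do rewrite unit10 unit11 b0l add0r -unitZ.
  under [X in _ + X]eq_bigr do rewrite unit00 unit01 b0r al0 addr0 -unitZ.
  by rewrite -!unitD -bq -bp -decV.
have [beta [betaK betaP]] := adjoint_involution alD alM alK EE hS h_herm hz hw.
split; [split|exists beta; split=> // c].
- move=> c d cd; apply: val_inj; apply: (rscale_faithful trV) => v.
  by rewrite -!EC cd.
- move=> A /(center_End EE trV) [c [cC cP]].
  exists (CentElt cC); apply: (act_faithful EE) => v.
  by rewrite EC cP.
(* Leaving the left slot of h, c becomes the left factor al c = sigma c; being central, this can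
   enter the right slot. *)
- apply: (form_faithful EE hz) => u v.
  rewrite -betaP !EC; have [hF _ hZ] := hS.
  rewrite hZ (hF _).2 (alphaC c : al (val c) = val (sigma c)).
  exact/centerP/(valP (sigma c)).
Qed.
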